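(* Let $\Gamma_{\mathbb{Q}}=\bigwedge_{i=1}^{k_1}(x^{a_i}\in\mathbb{Q})\wedge\bigwedge_{j=1}^{k_2}(x^{b_j}\notin\mathbb{Q})$ be a system of rationality constraints (with all $a_i,b_j$ positive integers) and let $c$ be an r-cell. If some transcendental real number $t\in c$ satisfies $\Gamma_{\mathbb{Q}}$ (i.e., $t^{a_i}\in\mathbb{Q}$ for all $i$ and $t^{b_j}\notin\mathbb{Q}$ for all $j$), then some real algebraic number in $c$ also satisfies $\Gamma_{\mathbb{Q}}$.
   Context: A real algebraic number is a real root of a nonzero polynomial in $\mathbb{Z}[x]$; a transcendental real is a real number that is not algebraic. An r-cell is a subset of $\mathbb{R}$ of one of the following forms, where $\alpha,\beta$ are real algebraic numbers: $\{\alpha\}$; $(-\infty,\alpha)$ with $\alpha\le 0$; $(\alpha,\beta)$ with $0\le\alpha<\beta$ or $\alpha<\beta\le 0$; $(\alpha,+\infty)$ with $\alpha\ge 0$. *)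

(* Defs.v *)
From mathcomp Require Import all_boot all_order all_algebra.
From mathcomp Require Import classical_sets set_interval reals.

Set Implicit Arguments.
Unset Strict Implicit.
Unset Printing Implicit Defensive.

Import Order.TTheory GRing.Theory Num.Theory.
Local Open Scope classical_set_scope.
Local Open Scope ring_scope.

(* mxpoly's [algebraicOver] requires the coefficients to lie in a field, hence
   this version with coefficients in [int]. *)
Definition algebraic_real (R : realType) (x : R) : Prop :=
  exists2 p : {poly int}, p != 0 & root (map_poly intr p) x.

Definition transcendental_real (R : realType) (x : R) : Prop :=
  ~ algebraic_real x.

Variant r_cell (R : realType) : set R -> Prop :=
| RCellPoint (alpha : R) of algebraic_real alpha :
    r_cell [set alpha]
| RCellLeftRay (alpha : R) of algebraic_real alpha & alpha <= 0 :
    r_cell `]-oo, alpha[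
| RCellSegment (alpha beta : R)
    of algebraic_real alpha & algebraic_real beta
    & (0 <= alpha < beta) || (alpha < beta <= 0) :
    r_cell `]alpha, beta[
| RCellRightRay (alpha : R) of algebraic_real alpha & 0 <= alpha :
    r_cell `]alpha, +oo[.

Definition satisfies_rationality (R : realType) (k1 k2 : nat)
    (a : 'I_k1 -> nat) (b : 'I_k2 -> nat) (x : R) : Prop :=
  (forall i, rational (x ^+ a i)) /\ (forall j, irrational (x ^+ b j)).

(* Main.v *)
Require Import Defs.
From mathcomp Require Import all_boot all_order all_algebra.
From mathcomp Require Import classical_sets reals.
From mathcomp Require Import ring.

(* If some [a i] occurs then [t] is a root of [X^(a i) - q] with [q] rational,
   contradicting transcendence; so only irrationality constraints remain, and
   [c] is an open interval avoiding 0. The numbers [r (1 + sqrt 2)] with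
   [r] rational and nonzero are algebraic and dense, and all their positive
   powers are irrational since [(1 + sqrt 2)^n = u + v sqrt 2] with [u], [v]
   positive integers for [0 < n]. *)

Import Order.TTheory GRing.Theory Num.Theory.
Local Open Scope ring_scope.

(** Clearing denominators changes [p] by a nonzero scalar only, so its roots stay the same. *)
Lemma algebraic_real_ratP (R : realType) (p : {poly rat}) (x : R) :
  p != 0 -> root (map_poly ratr p) x -> algebraic_real x.
Proof.
have [q [a a0 ->]] := rat_poly_scale p => pn0 px0.
exists q.
  by apply: contraNneq pn0 => ->; rewrite map_poly0 scaler0.
move: px0; rewrite map_polyZ rootZ ?fmorph_eq0 ?invr_eq0 ?intr_eq0 //.
rewrite -map_poly_comp (eq_map_poly (g := intr)) // => z /=.
exact: ratr_int.
Qed.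

Lemma rational_expr_algebraic (R : realType) (n : nat) (x : R) :
  (0 < n)%N -> rational (x ^+ n) -> algebraic_real x.
Proof.
move=> n_gt0 [q _ qE]; apply: (@algebraic_real_ratP R ('X^n - q%:P)).
  by rewrite -size_poly_eq0 size_XnsubC.
by rewrite rmorphB /= map_polyXn map_polyC /= /root !hornerE qE subrr.
Qed.

Lemma irrational_sqrt2 (R : realType) : irrational (Num.sqrt 2 : R).
Proof.
move=> [q _ qE].
have q2 : q ^+ 2 = 2.
  apply: (fmorph_inj (ratr : rat -> R)).
  by rewrite rmorphXn /= qE sqr_sqrtr // rmorph_nat.
have /(congr1 absz) : numq q ^+ 2 = 2 * denq q ^+ 2.
  apply: (intr_inj (R := rat)).
  rewrite [RHS]rmorphM !rmorphXn /= [2%:~R](esym q2) -exprMn.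
  by rewrite numqE.
(* The 2-adic valuation is even for a square and odd for twice a nonzero square. *)
rewrite abszM !abszX => /(congr1 (fun m => odd (logn 2 m))).
rewrite lognM ?expn_gt0 ?absz_gt0 ?denq_neq0 // !lognX.
by rewrite !mul2n oddD !odd_double (pfactorK 1).
Qed.

(** Multiplying by [1 + Num.sqrt 2] sends [(u, v)] to [(u + 2v, u + v)]. Positivity of [u] is
    carried along because [v] is 0 at the start. *)
Lemma expr_1Dsqrt2 (R : realType) (n : nat) :
  exists u v : nat, [/\ (0 < u)%N, (0 < n)%N ==> (0 < v)%N
    & (1 + Num.sqrt 2 : R) ^+ n = u%:R + v%:R * Num.sqrt 2].
Proof.
elim: n => [|n [u [v [u0 _ IH]]]].
  by exists 1, 0; split; rewrite // expr0 mul0r addr0.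
exists (u + v * 2)%N, (u + v)%N; split; rewrite ?addn_gt0 ?u0 //.
rewrite exprS IH !natrD natrM; have := sqr_sqrtr (ler0n R 2).
(* Writing 2 as [s ^+ 2] everywhere leaves a polynomial identity in [s]. *)
set s := Num.sqrt _ => s2; rewrite -s2; ring.
Qed.

Lemma irrational_expr_ratr_1Dsqrt2 (R : realType) (q : rat) (n : nat) :
  q != 0 -> (0 < n)%N -> irrational ((ratr q * (1 + Num.sqrt 2) : R) ^+ n).
Proof.
move=> q0 n_gt0 [p _ pE]; have [u [v [_ /implyP/(_ n_gt0) v0 uvE]]] :=
  @expr_1Dsqrt2 R n.
(* The witness solves [q ^+ n * (u + v * Num.sqrt 2) = p] for the square root. *)
apply: (@irrational_sqrt2 R); exists ((p / q ^+ n - u%:R) / v%:R) => //.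
have vn0 : v%:R != 0 :> R by rewrite pnatr_eq0 -lt0n.
have qn0 : (ratr q : R) ^+ n != 0 by rewrite expf_neq0 // fmorph_eq0.
rewrite fmorph_div rmorphB /= fmorph_div rmorphXn /= !rmorph_nat pE.
rewrite exprMn uvE mulrAC divff // mul1r addrAC subrr add0r.
by rewrite mulrAC divff // mul1r.
Qed.

Lemma algebraic_ratr_1Dsqrt2 (R : realType) (q : rat) :
  algebraic_real (ratr q * (1 + Num.sqrt 2) : R).
Proof.
(* The roots are [q * (1 + Num.sqrt 2)] and its conjugate. *)
pose p : {poly rat} := ('X - q%:P) ^+ 2 - (2 * q ^+ 2)%:P.
apply: (@algebraic_real_ratP R p).
  rewrite -size_poly_eq0 size_polyDl size_exp_XsubC // size_polyN.
  by rewrite size_polyC; case: eqP.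
rewrite /p rmorphB rmorphXn rmorphB /= map_polyX !map_polyC /= /root !hornerE.
rewrite !rmorphM rmorph_nat /=; apply/eqP.
have := sqr_sqrtr (ler0n R 2).
set s := Num.sqrt _ => s2; rewrite -s2; ring.
Qed.

(** Transcendence of [t] rules out a one-point cell; rays are cut to length 1 at their endpoint. The
    sign condition keeps 0 outside the interval, so that the rational factor chosen later is
    nonzero. *)
Lemma r_cell_itv (R : realType) (c : set R) (t : R) :
  r_cell c -> transcendental_real t -> c t ->
  exists x y : R, [/\ x < y, 0 <= x \/ y <= 0
    & forall z, x < z < y -> c z].
Proof.
case=> [a aA tA /= tE|a aA a0 _|a b aA bA ab _|a aA a0 _] /=.
- by case: tA; rewrite tE.
- exists (a - 1), a; split; [by rewrite gtrBl|by right|].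
  by move=> z /andP[_ za]; rewrite /= in_itv.
- exists a, b; split; last by move=> z; rewrite /= in_itv.
    by case/orP: ab => /andP[].
  by case/orP: ab => /andP[? ?]; [left|right].
- exists a, (a + 1); split; [by rewrite ltrDl|by left|].
  by move=> z /andP[az _]; rewrite /= in_itv /= az.
Qed.

Theorem theorem2 (R : realType) (k1 k2 : nat)
    (a : 'I_k1 -> nat) (b : 'I_k2 -> nat)
    (a_gt0 : forall i : 'I_k1, (0 < a i)%N)
    (b_gt0 : forall j : 'I_k2, (0 < b j)%N)
    (c : set R) (c_cell : r_cell c)
    (t : R) (t_trans : transcendental_real t) (t_in_c : c t)
    (t_sat : satisfies_rationality a b t) :
  exists s : R, [/\ algebraic_real s, c s & satisfies_rationality a b s].
Proof.
have [x [y [xy xy0 xyc]]] := r_cell_itv _ _ _ c_cell t_trans t_in_c.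
pose w : R := 1 + Num.sqrt 2.
have w0 : 0 < w by rewrite ltr_pwDl // sqrtr_ge0.
(* Scaling by [w] reduces density of the multiples [ratr q * w] to density of the rationals. *)
have : x / w < y / w by rewrite ltr_pM2r // invr_gt0.
move=> /rat_in_itvoo[q]; rewrite in_itv /= ltr_pdivrMr // ltr_pdivlMr // => qxy.
have q0 : q != 0.
  apply: contraTneq qxy => ->; rewrite rmorph0 mul0r.
  by case: xy0 => h; rewrite negb_and -!leNgt h ?orbT.
exists (ratr q * w); split; first exact: algebraic_ratr_1Dsqrt2.
  exact: xyc.
split=> [i|j]; last exact: irrational_expr_ratr_1Dsqrt2.
by case: t_trans; apply: rational_expr_algebraic (a_gt0 i) (t_sat.1 i).
Qed.
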